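(* (Barycentric Marsden identity.) Let $T=[v_1,v_2,v_3]\subset\mathbb{R}^2$ be a nondegenerate triangle with 12-split $T_{12}$, let $Q_1,\dots,Q_{39}$ be a basis of $\mathcal{S}^3_5(T_{12})$ consisting of simplex splines, let $w_1,\dots,w_{39}\in\mathbb{R}$ be weights, and let $p^*_{i,r}\in\mathbb{R}^2$ for $i=1,\dots,39$, $r=1,\dots,5$. Let $\beta_j=\beta_j(x)$, $j=1,2,3$, be the barycentric coordinates of $x\in\mathbb{R}^2$ with respect to $T$. Then the identity $$(1+x^{\mathsf T}y)^5=\sum_{i=1}^{39}w_iQ_i(x)\psi_i(y),\qquad x\in T,\ y\in\mathbb{R}^2,\qquad\text{where } \psi_i(y):=\prod_{r=1}^5\big(1+(p^*_{i,r})^{\mathsf T}y\big),$$ is equivalent to the identity $$(\beta_1c_1+\beta_2c_2+\beta_3c_3)^5=\sum_{i=1}^{39}w_iQ_i(\beta_1v_1+\beta_2v_2+\beta_3v_3)\Psi_i(c_1,c_2,c_3),\qquad x\in T,\ c_1,c_2,c_3\in\mathbb{R},$$ where, for $i=1,\dots,39$, $$\Psi_i(c_1,c_2,c_3):=\prod_{r=1}^5\big(\beta_1(p^*_{i,r})c_1+\beta_2(p^*_{i,r})c_2+\beta_3(p^*_{i,r})c_3\big).$$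
   Context: **12-split.** Let $v_4=\frac{v_1+v_2}2$, $v_5=\frac{v_2+v_3}2$, $v_6=\frac{v_1+v_3}2$, $v_7=\frac{v_4+v_6}2$, $v_8=\frac{v_4+v_5}2$, $v_9=\frac{v_5+v_6}2$, $v_{10}=\frac{v_1+v_2+v_3}3$. The 12-split $T_{12}$ is the triangulation of $T$ into 12 triangles obtained by drawing the segments $[v_1,v_5],[v_2,v_6],[v_3,v_4],[v_4,v_5],[v_5,v_6],[v_4,v_6]$; its vertices are $v_1,\dots,v_{10}$. $\mathcal{S}^3_5(T_{12})$ is the space of $C^3$ functions on $T$ that are polynomials of total degree at most 5 on each of the 12 triangles; it has dimension 39. **Simplex splines.** For a finite multiset $K=\{v_1^{m_1}\cdots v_{10}^{m_{10}}\}$ let $|K|=\sum m_i$ and $[K]$ its convex hull. For $x$ not on any line through two of the points $v_1,\dots,v_{10}$, define recursively $Q[K](x)=0$ if $\mathrm{area}([K])=0$; $Q[K](x)=\mathbf 1_{[K]}(x)\,\mathrm{area}(T)/\mathrm{area}([K])$ if $\mathrm{area}([K])\ne0$ and $|K|=3$; and $Q[K](x)=\sum_{j=1}^{10}\beta_jQ[K\setminus v_j](x)$ if $\mathrm{area}([K])\neq 0$ and $|K|>3$, where $x=\sum_j\beta_jv_j$, $\sum_j\beta_j=1$, $\beta_j=0$ whenever $m_j=0$, and $K\setminus v_j$ removes one copy of $v_j$ (the value does not depend on the choice of the $\beta_j$). On $T$ the function $Q[K]$ is extended by continuity whenever possible; a simplex spline is a function $Q[K]$ of this form. *)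

(* Defs.v *)
From HB Require Import structures.
From mathcomp Require Import all_boot all_order all_algebra.
From mathcomp Require Import all_classical all_reals all_analysis.
From mathcomp Require Import ring lra.

Set Implicit Arguments.
Unset Strict Implicit.
Unset Printing Implicit Defensive.

Import Order.TTheory GRing.Theory Num.Theory.
Import numFieldNormedType.Exports.

Local Open Scope classical_set_scope.
Local Open Scope ring_scope.

(** Points of the plane are column vectors ['cV[R]_2].  Indices are shifted by
    one: the vertices v_1, v_2, v_3 of a triangle are [v 0], [v 1], [v 2] for
    [v : 'I_3 -> 'cV[R]_2], and v_k is the entry [k - 1] of [vertices12 v]. *)

Definition dotp (R : realType) (x y : 'cV[R]_2) : R := (x^T *m y) 0 0.

Definition hull (R : realType) (A : set 'cV[R]_2) : set 'cV[R]_2 :=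
  smallest (@convex_set R _) A.

Definition triangle (R : realType) (v : 'I_3 -> 'cV[R]_2) : set 'cV[R]_2 :=
  hull (range v).

Definition nondegenerate_triangle (R : realType) (v : 'I_3 -> 'cV[R]_2) : bool :=
  free [:: v 1 - v 0; v 2 - v 0].

(** Two-dimensional Lebesgue measure, carried from [R * R] to ['cV[R]_2]. *)
Definition area (R : realType) (A : set 'cV[R]_2) : R :=
  fine ((@lebesgue_measure R \x @lebesgue_measure R)%E
          [set s : R * R | A (\col_i (if i == 0 then s.1 else s.2))]).

(** The coefficient families that write [x] as an affine combination of those
    points [p j] for which [S j] holds. *)
Definition affine_coords (R : realType) (n : nat) (p : 'I_n -> 'cV[R]_2)
    (S : pred 'I_n) (x : 'cV[R]_2) : set ('I_n -> R) :=
  [set b | [/\ \sum_j b j = 1, x = \sum_j b j *: p j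
             & forall j, ~~ S j -> b j = 0]].

(** If [v] is nondegenerate these coordinates exist and are unique, see
    [baryP] and [bary_uniq]. *)
Definition bary (R : realType) (v : 'I_3 -> 'cV[R]_2) (x : 'cV[R]_2) :
    'I_3 -> R :=
  get (affine_coords v predT x).

Definition midpoint (R : realType) (a b : 'cV[R]_2) : 'cV[R]_2 :=
  2^-1 *: (a + b).

Definition vertices12 (R : realType) (v : 'I_3 -> 'cV[R]_2) : seq 'cV[R]_2 :=
  let v1 := v 0 in
  let v2 := v 1 in
  let v3 := v 2 in
  let v4 := midpoint v1 v2 in
  let v5 := midpoint v2 v3 in
  let v6 := midpoint v1 v3 in
  let v7 := midpoint v4 v6 in
  let v8 := midpoint v4 v5 in
  let v9 := midpoint v5 v6 in
  let v10 := 3^-1 *: (v1 + v2 + v3) in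
  [:: v1; v2; v3; v4; v5; v6; v7; v8; v9; v10].

Definition vertex12 (R : realType) (v : 'I_3 -> 'cV[R]_2) (i : 'I_10) :
    'cV[R]_2 :=
  (vertices12 v)`_i.

(** The twelve triangles cut out by the three medians and by the three sides of
    the medial triangle [v_4, v_5, v_6]: two at each corner of the triangle, and
    the six into which the medians cut the medial triangle.  The entries are
    positions in [vertices12 v]. *)
Definition faces12 : seq (nat * nat * nat) :=
  [:: (0, 3, 6); (0, 6, 5); (1, 3, 7); (1, 7, 4); (2, 4, 8); (2, 8, 5);
      (3, 6, 9); (3, 7, 9); (4, 7, 9); (4, 8, 9); (5, 8, 9); (5, 6, 9)]%N.

Definition face_set (R : realType) (v : 'I_3 -> 'cV[R]_2)
    (t : nat * nat * nat) : set 'cV[R]_2 :=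
  let: (a, b, c) := t in
  hull [set (vertices12 v)`_a; (vertices12 v)`_b; (vertices12 v)`_c].

Definition polynomial_on (R : realType) (d : nat) (D : set 'cV[R]_2)
    (f : 'cV[R]_2 -> R) : Prop :=
  exists a : nat -> nat -> R, forall x, D x ->
    f x = \sum_(i < d.+1) \sum_(j < d.+1 | (i + j <= d)%N)
            a i j * x 0 0 ^+ i * x 1 0 ^+ j.

(** [f] is of class C^k on the closed set [D]: its partial derivatives up to
    order [k] exist in the interior of [D] and extend continuously to [D]. *)
Fixpoint class_C (R : realType) (k : nat) (D : set 'cV[R]_2)
    (f : 'cV[R]_2 -> R) : Prop :=
  {within D, continuous f} /\
  if k is k'.+1 then
    forall i : 'I_2, exists g : 'cV[R]_2 -> R,
      class_C k' D g /\
      forall x, D° x -> is_derive x (delta_mx i 0 : 'cV[R]_2) f (g x)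
  else True.

(** A function on the triangle is represented by a function on the plane, only
    the values of which on the triangle are constrained. *)
Definition spline_space (R : realType) (r d : nat) (v : 'I_3 -> 'cV[R]_2)
    (f : 'cV[R]_2 -> R) : Prop :=
  class_C r (triangle v) f /\
  forall t, t \in faces12 -> polynomial_on d (face_set v t) f.

Definition is_basis_on (R : realType) (n : nat) (D : set 'cV[R]_2)
    (S : ('cV[R]_2 -> R) -> Prop) (Q : 'I_n -> 'cV[R]_2 -> R) : Prop :=
  [/\ forall i, S (Q i),
      forall a : 'I_n -> R,
        (forall x, D x -> \sum_i a i * Q i x = 0) -> forall i, a i = 0
    & forall f, S f -> exists a : 'I_n -> R,
        forall x, D x -> f x = \sum_i a i * Q i x].

(** A multiset of vertices of the 12-split is given by its multiplicities. *)
Definition mset_hull (R : realType) (v : 'I_3 -> 'cV[R]_2)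
    (m : 'I_10 -> nat) : set 'cV[R]_2 :=
  hull [set vertex12 v j | j in [set j | (0 < m j)%N]].

Definition mset_remove (m : 'I_10 -> nat) (j : 'I_10) : 'I_10 -> nat :=
  fun i => (m i - (i == j))%N.

Definition generic (R : realType) (v : 'I_3 -> 'cV[R]_2) (x : 'cV[R]_2) : Prop :=
  forall i j, vertex12 v i != vertex12 v j ->
    forall t : R, x <> vertex12 v i + t *: (vertex12 v j - vertex12 v i).

(** The recursion for Q[K](x), where [n] stands for |K| - 3.  The coefficients
    of the recursion are not unique when K has more than three distinct points;
    some admissible choice is made, and at generic points the value does not
    depend on it.  A term with [m j = 0] has coefficient 0. *)
Fixpoint simplex_rec (R : realType) (v : 'I_3 -> 'cV[R]_2) (n : nat)
    (m : 'I_10 -> nat) (x : 'cV[R]_2) : R :=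
  if area (mset_hull v m) == 0 then 0 else
  if n is n'.+1 then
    let b := get (affine_coords (vertex12 v) (fun j => (0 < m j)%N) x) in
    \sum_j b j * simplex_rec v n' (mset_remove m j) x
  else \1_(mset_hull v m) x * area (triangle v) / area (mset_hull v m).

Definition simplex_generic (R : realType) (v : 'I_3 -> 'cV[R]_2)
    (m : 'I_10 -> nat) (x : 'cV[R]_2) : R :=
  simplex_rec v ((\sum_j m j) - 3)%N m x.

(** [q] is Q[K] on the triangle: it has the recursive value at generic points
    and is the extension by continuity wherever the limit exists. *)
Definition is_simplex_spline_of (R : realType) (v : 'I_3 -> 'cV[R]_2)
    (m : 'I_10 -> nat) (q : 'cV[R]_2 -> R) : Prop :=
  forall x, triangle v x ->
    (generic v x -> q x = simplex_generic v m x) /\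
    (~ generic v x -> forall l : R,
       simplex_generic v m y
         @[y --> within (triangle v `&` [set z | generic v z]) (nbhs x)] --> l ->
       q x = l).

Definition is_simplex_spline (R : realType) (v : 'I_3 -> 'cV[R]_2)
    (q : 'cV[R]_2 -> R) : Prop :=
  exists m : 'I_10 -> nat, is_simplex_spline_of v m q.

Lemma big_ord3 (V : nmodType) (F : 'I_3 -> V) :
  \sum_j F j = F 0 + F 1 + F 2.
Proof.
rewrite !big_ord_recl big_ord0 addr0 addrA.
by congr (F _ + F _ + F _); apply/val_inj.
Qed.

Lemma bary_uniq (R : realType) (v : 'I_3 -> 'cV[R]_2) (x : 'cV[R]_2)
    (b b' : 'I_3 -> R) :
  nondegenerate_triangle v -> affine_coords v predT x b -> affine_coords v predT x b' ->
  b = b'.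
Proof.
move=> nd [b1 bx _] [b1' bx' _].
rewrite big_ord3 in b1; rewrite big_ord3 in b1'.
rewrite big_ord3 in bx; rewrite big_ord3 in bx'.
pose k (i : 'I_2) := if i == 0 then b 1 - b' 1 else b 2 - b' 2.
have S : \sum_(i < 2) k i *: [:: v 1 - v 0; v 2 - v 0]`_i = 0.
  rewrite !big_ord_recl big_ord0 /= addr0 /k /=.
  apply/colP => r.
  have := congr1 (fun z : 'cV[R]_2 => z r 0) bx.
  have := congr1 (fun z : 'cV[R]_2 => z r 0) bx'.
  rewrite /= !mxE => -> e.
  have e0 : b 0 = 1 - b 1 - b 2 by lra.
  have e0' : b' 0 = 1 - b' 1 - b' 2 by lra.
  move: e; rewrite e0 e0'; lra.
have H := @freeP _ _ 2 (in_tuple [:: v 1 - v 0; v 2 - v 0]) nd k S.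
have h1 : b 1 - b' 1 = 0 := H 0.
have h2 : b 2 - b' 2 = 0 := H 1.
apply/funext => -[[|[|[|//]]] i].
- have -> : Ordinal i = 0 by apply/val_inj.
  lra.
- have -> : Ordinal i = 1 by apply/val_inj.
  lra.
- have -> : Ordinal i = 2 by apply/val_inj.
  lra.
Qed.

Lemma baryP (R : realType) (v : 'I_3 -> 'cV[R]_2) (x : 'cV[R]_2) :
  nondegenerate_triangle v -> affine_coords v predT x (bary v x).
Proof.
move=> nd; apply: (@getPex _ (affine_coords v predT x)).
have full : span [:: v 1 - v 0; v 2 - v 0] = fullv.
  by apply/eqP; rewrite eqEdim subvf (eqP nd) dimvf.
have : x - v 0 \in span (in_tuple [:: v 1 - v 0; v 2 - v 0]).
  by rewrite [in_tuple _ : seq _]/= full memvf.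
move=> /coord_span; set c := coord _.
rewrite !big_ord_recl big_ord0 /= addr0.
set s := c _ _; set t := c _ _ => e.
exists (fun i : 'I_3 => if i == 0 then 1 - s - t else if i == 1 then s else t).
split=> //; rewrite big_ord3 /=; first by ring.
apply/colP => r; have := congr1 (fun z : 'cV[R]_2 => z r 0) e.
rewrite /= !mxE; lra.
Qed.

(* Main.v *)
Require Import Defs.
From mathcomp Require Import all_boot all_order all_algebra.
From mathcomp Require Import all_classical all_reals all_analysis.
From mathcomp Require Import ring.

Set Implicit Arguments.
Unset Strict Implicit.
Unset Printing Implicit Defensive.

Import Order.TTheory GRing.Theory Num.Theory.

Local Open Scope ring_scope.

(** For a nondegenerate triangle, the affine functions of [x] are exactly the
    functions [\sum_j bary v x j * c j], where [c j] is the value at the vertex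
    [v j]; they are also exactly the functions [s + dotp x y].  The first
    identity is thus the second one restricted to those [c] for which the
    affine function takes the value [s = 1] at the origin, and this gives one
    implication by taking [c j = 1 + dotp (v j) y]
    ([bary_sum_affine]).

    For the other implication, [bary_sumE] turns an arbitrary [c] into a pair
    [(s, y)], so it suffices to prove, for a fixed [x], the homogenized identity
    [(s + dotp x y) ^+ 5 = \sum_i k_i * \prod_r (s + dotp (p i r) y)]
    with [k_i = w i * Q i x].  Both
    sides are homogeneous of degree 5 in [(s, y)], so for nonzero [s] it follows
    from the case [s = 1] at [s^-1 *: y].  Both sides are polynomials in [s], so
    it extends to [s = 0] ([homogenize_identity]). *)

Lemma dotpE (R : realType) (x y : 'cV[R]_2) :
  dotp x y = x 0 0 * y 0 0 + x 1 0 * y 1 0.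
Proof.
rewrite /dotp mxE !big_ord_recl big_ord0 addr0 !mxE.
by congr (_ + x _ _ * y _ _); apply/val_inj.
Qed.

Lemma dotpZr (R : realType) (a : R) (x y : 'cV[R]_2) :
  dotp x (a *: y) = a * dotp x y.
Proof. by rewrite !dotpE !mxE; ring. Qed.

Lemma bary_sum1 (R : realType) (v : 'I_3 -> 'cV[R]_2) (x : 'cV[R]_2) :
  nondegenerate_triangle v -> \sum_j bary v x j = 1.
Proof. by move=> /(baryP x)[]. Qed.

Lemma bary_sumZ (R : realType) (v : 'I_3 -> 'cV[R]_2) (x : 'cV[R]_2) :
  nondegenerate_triangle v -> \sum_j bary v x j *: v j = x.
Proof. by move=> /(baryP x)[]. Qed.

Lemma bary_sum_affine (R : realType) (v : 'I_3 -> 'cV[R]_2) (s : R)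
    (x y : 'cV[R]_2) :
  nondegenerate_triangle v ->
  \sum_j bary v x j * (s + dotp (v j) y) = s + dotp x y.
Proof.
move=> nd.
have /esym := bary_sum1 x nd; rewrite big_ord3 => b1.
rewrite -[in RHS](bary_sumZ x nd) -[s in RHS]mul1r b1 !big_ord3 !dotpE !mxE.
by ring.
Qed.

(** [x] is the affine combination, with weights [x 0 0], [x 1 0] and
    [1 - x 0 0 - x 1 0], of the two unit vectors and the origin; by uniqueness
    of barycentric coordinates, [bary] preserves this combination. *)
Lemma bary_affine (R : realType) (v : 'I_3 -> 'cV[R]_2) (x : 'cV[R]_2)
    (j : 'I_3) :
  nondegenerate_triangle v ->
  bary v x j = x 0 0 * bary v (delta_mx 0 0) j + x 1 0 * bary v (delta_mx 1 0) j
               + (1 - x 0 0 - x 1 0) * bary v 0 j.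
Proof.
move=> nd.
pose b k := x 0 0 * bary v (delta_mx 0 0) k + x 1 0 * bary v (delta_mx 1 0) k
            + (1 - x 0 0 - x 1 0) * bary v 0 k.
suff /(bary_uniq nd (baryP x nd)) -> : affine_coords v predT x b by [].
split=> //.
  by rewrite !big_split -!mulr_sumr /= !bary_sum1 //; ring.
have -> : \sum_k b k *: v k =
    x 0 0 *: (\sum_k bary v (delta_mx 0 0) k *: v k) +
    x 1 0 *: (\sum_k bary v (delta_mx 1 0) k *: v k) +
    (1 - x 0 0 - x 1 0) *: (\sum_k bary v 0 k *: v k).
  by rewrite !scaler_sumr -!big_split; apply: eq_bigr => k _;
    rewrite /= !scalerA -!scalerDl.
rewrite !bary_sumZ // scaler0 addr0.
apply/colP => -[[|[|//]] lt_i]; rewrite !mxE /= ?mulr1 ?mulr0 ?addr0 ?add0r.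
  by congr (x _ _); apply/val_inj.
by congr (x _ _); apply/val_inj.
Qed.

(** Affine interpolation: [s] is the value at the origin of the affine function
    with vertex values [c], and [y] is its gradient. *)
Lemma bary_sumE (R : realType) (v : 'I_3 -> 'cV[R]_2) (c : 'I_3 -> R) :
  nondegenerate_triangle v ->
  exists s y, forall x, \sum_j bary v x j * c j = s + dotp x y.
Proof.
move=> nd; pose g x := \sum_j bary v x j * c j.
exists (g 0), (\col_i (g (delta_mx i 0) - g 0)) => x.
rewrite dotpE !mxE /g !big_ord3 !(bary_affine x _ nd).
by ring.
Qed.

Lemma poly_eq0_nonzero (R : numDomainType) (P : {poly R}) :
  (forall t, t != 0 -> P.[t] = 0) -> P = 0.
Proof.
move=> P0; pose rs : seq R := [seq i.+1%:R | i <- iota 0 (size P)].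
apply: (@roots_geq_poly_eq0 _ _ rs); last by rewrite size_map size_iota.
  by apply/allP => _ /mapP[i _ ->]; apply/eqP/P0; rewrite pnatr_eq0.
by rewrite map_inj_uniq ?iota_uniq // => i j /eqP; rewrite eqr_nat => /eqP[].
Qed.

(** Scaling by [t] reaches every nonzero value of [s] only; those with [s = 0]
    are the affine functions that vanish at the origin, and they are reached
    because, for a fixed [y], the difference of the sides is a polynomial in
    [s]. *)
Lemma homogenize_identity (R : realType) (I : finType) (n : nat)
    (x : 'cV[R]_2) (p : I -> 'I_n -> 'cV[R]_2) (k : I -> R) :
  (forall y, (1 + dotp x y) ^+ n = \sum_i k i * \prod_r (1 + dotp (p i r) y)) ->
  forall s y, (s + dotp x y) ^+ n = \sum_i k i * \prod_r (s + dotp (p i r) y).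
Proof.
move=> h s y.
pose P : {poly R} := ('X + (dotp x y)%:P) ^+ n
  - \sum_i (k i)%:P * \prod_r ('X + (dotp (p i r) y)%:P).
have PE t : P.[t] = (t + dotp x y) ^+ n
    - \sum_i k i * \prod_r (t + dotp (p i r) y).
  rewrite /P hornerD hornerN horner_exp hornerD hornerX hornerC horner_sum.
  congr (_ - _); apply: eq_bigr => i _.
  rewrite hornerM hornerC horner_prod; congr (_ * _).
  by apply: eq_bigr => r _; rewrite hornerD hornerX hornerC.
suff P0 : P = 0 by apply/subr0_eq; rewrite -PE P0 horner0.
apply: poly_eq0_nonzero => t t0; rewrite PE; apply/eqP; rewrite subr_eq0.
apply/eqP.
have scale z : t + dotp z y = t * (1 + dotp z (t^-1 *: y)).
  by rewrite dotpZr mulrDr mulr1 mulVKf.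
rewrite scale exprMn h mulr_sumr; apply: eq_bigr => i _.
rewrite mulrCA; congr (_ * _).
rewrite (eq_bigr _ (fun r _ => scale (p i r))) big_split /=.
by rewrite prodr_const card_ord.
Qed.

Theorem theorem5 (R : realType) (v : 'I_3 -> 'cV[R]_2)
    (Q : 'I_39 -> 'cV[R]_2 -> R) (w : 'I_39 -> R)
    (p : 'I_39 -> 'I_5 -> 'cV[R]_2)
    (hv : nondegenerate_triangle v)
    (hQ : is_basis_on (triangle v) (spline_space 3 5 v) Q)
    (hQs : forall i, is_simplex_spline v (Q i)) :
  (forall x y : 'cV[R]_2, triangle v x ->
     (1 + dotp x y) ^+ 5 =
     \sum_i w i * Q i x * \prod_r (1 + dotp (p i r) y))
  <->
  (forall (x : 'cV[R]_2) (c : 'I_3 -> R), triangle v x ->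
     (\sum_j bary v x j * c j) ^+ 5 =
     \sum_i w i * Q i (\sum_j bary v x j *: v j) *
       \prod_r (\sum_j bary v (p i r) j * c j)).
Proof.
split=> [h x c Tx | h x y Tx].
  have [s [y cE]] := bary_sumE c hv.
  rewrite bary_sumZ // cE.
  under eq_bigr => i _ do under eq_bigr => r _ do rewrite cE.
  by apply: homogenize_identity => z; exact: h.
have := h x (fun j => 1 + dotp (v j) y) Tx.
rewrite bary_sumZ // bary_sum_affine // => ->.
apply: eq_bigr => i _; congr (_ * _).
by apply: eq_bigr => r _; rewrite bary_sum_affine.
Qed.
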